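(* Let $m\ge 2$ and let $X$ and $Y$ be Banach spaces. (1) If $P\in\mathcal{P}(^mX;Y)$ is compact, then $\tilde a_n(P)=a_n(P^* )$ for every $n\in\mathbb{N}$. (2) For every $P\in\mathcal{P}(^mX;Y)$ we have $\tilde a_n(P)\le 5\,a_n(P^* )$ for every $n\in\mathbb{N}$.
   Context: Banach spaces are over $\mathbb{K}=\mathbb{R}$ or $\mathbb{C}$; $\mathbb{N}$ is the set of positive integers. $\mathcal{P}(^mX;Y)$ is the Banach space of continuous $m$-homogeneous polynomials $P:X\to Y$, i.e. maps $P(x)=A(x,\ldots,x)$ with $A:X\times\cdots\times X\to Y$ a continuous $m$-linear map, with norm $\|P\|=\sup\{\|P(x)\|:\|x\|\le 1\}$; $\mathcal{P}(^mX)=\mathcal{P}(^mX;\mathbb{K})$ and $\mathcal{L}(X;Y)=\mathcal{P}(^1X;Y)$. $P$ is compact if $P(\overline{B}_X)$ is relatively compact in $Y$, where $\overline{B}_X$ is the closed unit ball of $X$. The rank of $P$ is the dimension of the linear span of $P(X)$ in $Y$. The $n$-th approximation number of $P\in\mathcal{P}(^mX;Y)$ is $\tilde a_n(P)=\inf\{\|P-Q\|: Q\in\mathcal{P}(^mX;Y),\ \mathrm{rank}(Q)<n\}$; for a linear operator $T\in\mathcal{L}(X;Y)$, $a_n(T)=\inf\{\|T-L\|: L\in\mathcal{L}(X;Y),\ \mathrm{rank}(L)<n\}$. The adjoint of $P$ is the continuous linear operator $P^*:Y^*\to\mathcal{P}(^mX)$, $P^*(\varphi)(x)=\varphi(P(x))$.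 *)

(* Defs.v *)
From HB Require Import structures.
From mathcomp Require Import all_boot all_order all_algebra.
From mathcomp Require Import complex.
From mathcomp Require Import all_classical all_reals all_analysis.

Set Implicit Arguments.
Unset Strict Implicit.
Unset Printing Implicit Defensive.

Import Order.TTheory GRing.Theory Num.Theory.
Import numFieldNormedType.Exports.

Local Open Scope classical_set_scope.
Local Open Scope ring_scope.

Variant scalar_kind := RealScalars | ComplexScalars.

Definition scalars (R : realType) (k : scalar_kind) : numFieldType :=
  match k with RealScalars => R | ComplexScalars => R[i] end.

Lemma continuous_diag (I : Type) (V : topologicalType) :
  continuous ((fun x => (fun=> x)) : V -> {ptws I -> V}).
Proof.
move=> x; apply/cvg_sup => i U.
have /= -> := @nbhsE (initial_topology (fun f : I -> V => f i)) (fun=> x).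
case=> B [[C oC <-] /= Cx] BU.
rewrite nbhs_simpl /=; apply: filterS (open_nbhs_nbhs (conj oC Cx)) => y Cy.
exact: BU.
Qed.

Section Multilinear.
Context {K : numFieldType} (m : nat) {X Y : normedModType K}.

Definition set_arg (v : 'I_m -> X) (i : 'I_m) (x : X) : 'I_m -> X :=
  fun j => if j == i then x else v j.

Definition multilinear (A : ('I_m -> X) -> Y) : Prop :=
  forall (i : 'I_m) (v : 'I_m -> X) (a : K) (x y : X),
    A (set_arg v i (a *: x + y)) = a *: A (set_arg v i x) + A (set_arg v i y).

(* [ptws] is the product topology. *)
Definition is_hpoly (f : X -> Y) : Prop :=
  exists A : {ptws 'I_m -> X} -> Y,
    [/\ multilinear A, continuous A & forall x, f x = A (fun=> x)].

Definition hpoly_pred : {pred X -> Y} := fun f => `[< is_hpoly f >].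

Lemma hpolyP f : reflect (is_hpoly f) (f \in hpoly_pred).
Proof. exact: asboolP. Qed.

Lemma continuous_lincomb (T : topologicalType) (a : K) (f g : T -> Y) :
  continuous f -> continuous g -> continuous (fun t => a *: f t + g t).
Proof.
by move=> cf cg t; apply: cvgD; [apply: cvgZr; exact: cf | exact: cg].
Qed.

Lemma is_hpoly_submod : submod_closed hpoly_pred.
Proof.
split=> [|a f g /hpolyP [A [linA ctsA fA]] /hpolyP [B [linB ctsB gB]]].
  apply/hpolyP; exists (cst 0 : {ptws 'I_m -> X} -> Y); split.
  - by move=> i v a x y; rewrite scaler0 addr0.
  - exact: (@cst_continuous {ptws 'I_m -> X} Y 0).
  - by [].
apply/hpolyP; exists (fun v => a *: A v + B v); split.
- move=> i v b x y; rewrite linA linB !scalerDr addrACA !scalerA.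
  by rewrite [b * a]mulrC.
- exact: (@continuous_lincomb {ptws 'I_m -> X} a A B ctsA ctsB).
- by move=> x; rewrite -fA -gB.
Qed.

HB.instance Definition _ :=
  GRing.isSubmodClosed.Build K (X -> Y) hpoly_pred is_hpoly_submod.

Lemma multilinear_diagZ (A : ('I_m -> X) -> Y) : multilinear A ->
  forall a x, A (fun=> a *: x) = a ^+ m *: A (fun=> x).
Proof.
move=> linA a x.
pose v k : 'I_m -> X := fun i => if (i < k)%N then a *: x else x.
have A0 i w : A (set_arg w i 0) = 0.
  by have := linA i w (-1) 0 0; rewrite scaler0 addr0 scaleN1r addNr.
have AZ i w y : A (set_arg w i (a *: y)) = a *: A (set_arg w i y).
  by have := linA i w a y 0; rewrite A0 !addr0.
have step k : (k <= m)%N -> A (v k) = a ^+ k *: A (v 0%N).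
  elim: k => [|k IH] km; first by rewrite expr0 scale1r.
  pose i := Ordinal km.
  have -> : v k.+1 = set_arg (v k) i (a *: x).
    apply/funext => j; rewrite /set_arg /v ltnS leq_eqVlt.
    by rewrite -val_eqE /=; case: (j == k :> nat).
  rewrite AZ exprS -scalerA -IH 1?ltnW //; congr (_ *: A _).
  apply/funext => j; rewrite /set_arg /v -val_eqE /=.
  by case: eqP => // ->; rewrite ltnn.
have -> : (fun=> a *: x) = v m by apply/funext => j; rewrite /v ltn_ord.
have -> : (fun=> x) = v 0%N by apply/funext => j; rewrite /v.
exact: step.
Qed.

Lemma is_hpolyZ f : is_hpoly f -> forall a x, f (a *: x) = a ^+ m *: f x.
Proof.
by case=> A [linA _ fA] a x; rewrite !fA; exact: (multilinear_diagZ linA).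
Qed.

Lemma is_hpoly_continuous f : is_hpoly f -> continuous f.
Proof.
case=> A [_ ctsA fA].
have -> : f = A \o ((fun x => (fun=> x)) : X -> {ptws 'I_m -> X}).
  by apply/funext.
by move=> x; exact: (continuous_comp (@continuous_diag 'I_m X x) (ctsA _)).
Qed.

Lemma is_hpoly_bounded f : is_hpoly f ->
  exists2 M : K, 0 <= M & forall x, `|x| <= 1 -> `|f x| <= M.
Proof.
move=> fP.
have f0 : f x @[x --> 0] --> f 0 by exact: (is_hpoly_continuous fP).
have /cvgrPdist_lt/(_ 1 ltr01) /nbhs_norm0P [e /= e0 fe] := f0.
pose d := e / 2.
have d0 : 0 < d by rewrite divr_gt0.
have dm0 : d ^+ m != 0 by rewrite expf_neq0 // gt_eqF.
exists ((d ^- m) * (`|f 0| + 1)).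
  by rewrite mulr_ge0 ?invr_ge0 ?exprn_ge0 ?addr_ge0 // ltW.
move=> x x1.
have dx : `|d *: x| < e.
  rewrite normrZ gtr0_norm //; apply: (@le_lt_trans _ _ d).
    by rewrite ger_pMr.
  by rewrite /d ltr_pdivrMr // ltr_pMr // ltr1n.
have fdx : `|f (d *: x)| <= `|f 0| + 1.
  have -> : f (d *: x) = f 0 - (f 0 - f (d *: x)) by rewrite subKr.
  apply: (le_trans (ler_normB _ _)); rewrite lerD2l; apply: ltW; exact: fe.
rewrite -ler_pdivrMl ?invr_gt0 ?exprn_gt0 // invrK.
by move: fdx; rewrite (is_hpolyZ fP) normrZ normrX gtr0_norm.
Qed.

End Multilinear.

Record hpoly (K : numFieldType) (m : nat) (X Y : normedModType K) := HPoly {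
  hpoly_fun :> X -> Y;
  hpoly_funP : hpoly_fun \in hpoly_pred m }.

Section HPolyModule.
Context (K : numFieldType) (m : nat) (X Y : normedModType K).

HB.instance Definition _ := [isSub for @hpoly_fun K m X Y].
HB.instance Definition _ := [Choice of hpoly m X Y by <:].
HB.instance Definition _ := [SubChoice_isSubLmodule of hpoly m X Y by <:].

End HPolyModule.

Section NormAndRank.
Context {K : numFieldType}.

(* [supremum] and [infimum] are taken for the order of K, for which
   x <= y means that y - x is a nonnegative real: over the complex numbers the
   supremum of a nonempty bounded set of real numbers is the usual one, and
   likewise for the infimum. *)
Definition hpoly_norm (m : nat) (X Y : normedModType K) (P : hpoly m X Y) : K :=
  supremum 0 [set `|P x| | x in [set x : X | `|x| <= 1]].

Definition lin_span (V : lmodType K) (S : set V) : set V :=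
  [set y | exists n (c : 'I_n -> K) (v : 'I_n -> V),
     (forall i, S (v i)) /\ y = \sum_i c i *: v i].

Definition has_dim (V : lmodType K) (S : set V) (d : nat) : Prop :=
  exists b : 'I_d -> V,
    [/\ forall i, S (b i),
        forall c : 'I_d -> K, \sum_i c i *: b i = 0 -> forall i, c i = 0
      & forall y, S y -> exists c : 'I_d -> K, y = \sum_i c i *: b i].

Definition rank_lt (m : nat) (X Y : normedModType K) (P : hpoly m X Y)
    (n : nat) : Prop :=
  exists2 d : nat, (d < n)%N & has_dim (lin_span (range P)) d.

Definition compact_hpoly (m : nat) (X Y : normedModType K) (P : hpoly m X Y) :
    Prop :=
  precompact (P @` [set x : X | `|x| <= 1]).

End NormAndRank.

Lemma scalars_supremums (R : realType) (k : scalar_kind)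
    (A : set (scalars R k)) (M : scalars R k) :
  A !=set0 -> (forall x, A x -> 0 <= x <= M) -> supremums A !=set0.
Proof.
case: k A M => /= A M A0 AM.
  have supA : has_sup A.
    by split=> //; exists M => x /AM /andP[].
  exists (sup A); split; first exact/ubP/sup_upper_bound.
  by move=> y yA; apply: sup_le_ub.
pose B : set R := [set complex.Re x | x in A].
have Areal x : A x -> x = (complex.Re x)%:C%C.
  by case: x => a b /AM /andP[]; rewrite lecE /= => /andP[/eqP -> _].
have supB : has_sup B.
  split; first by case: A0 => x Ax; exists (complex.Re x), x.
  exists (complex.Re M) => _ [x /AM /andP[_ xM] <-].
  by move: xM; rewrite lecE => /andP[].
exists (sup B)%:C%C; split.
  move=> x Ax; rewrite [x]Areal // lecR.
  by apply: sup_upper_bound => //; exists x.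
move=> y yA; case: A0 => x0 Ax0.
have yreal : y = (complex.Re y)%:C%C.
  have := yA _ Ax0; rewrite [x0]Areal //; case: (y) => a b.
  by rewrite lecE /= => /andP[/eqP -> _].
rewrite yreal lecR; apply: sup_le_ub; first by exists (complex.Re x0), x0.
move=> _ [x Ax <-]; have := yA _ Ax; rewrite {1}[x]Areal // lecE.
by case/andP.
Qed.

Lemma scalars_infimums (R : realType) (k : scalar_kind)
    (A : set (scalars R k)) :
  A !=set0 -> (forall x, A x -> 0 <= x) -> infimums A !=set0.
Proof.
case=> a Aa A0.
have [||s [sL Ls]] := @scalars_supremums R k [set y | 0 <= y /\ lbound A y] a.
- by exists 0; split.
- by move=> y [-> yA] /=; exact: yA.
have s0 : 0 <= s by apply: sL; split.
exists s; split=> [x Ax|y yA]; first by apply: Ls => y [_]; exact.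
have yreal : y \is Num.real.
  have ay : 0 <= a - y by rewrite subr_ge0 yA.
  by rewrite -(subKr a y) realB // ger0_real // A0.
have [y0|/ltW y0] := real_ge0P yreal; first by apply: sL; split.
exact: le_trans y0 s0.
Qed.

Section NormedHPoly.
Context (R : realType) (k : scalar_kind) (m : nat).
Local Notation K := (scalars R k).
Context (X Y : normedModType K).
Implicit Types P Q : hpoly m X Y.

Lemma hpolyZ P a x : P (a *: x) = a ^+ m *: P x.
Proof. exact: is_hpolyZ (elimT (hpolyP _ _) (hpoly_funP P)) a x. Qed.

Let norm_set P : set K := [set `|P x| | x in [set x : X | `|x| <= 1]].

Let norm_set0 P : norm_set P !=set0.
Proof. by exists `|P 0|, 0 => //=; rewrite normr0. Qed.

Lemma hpoly_norm_supremums P : supremums (norm_set P) (hpoly_norm P).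
Proof.
rewrite /hpoly_norm /supremum ifF; last by apply/negbTE/set0P; exact: norm_set0.
apply: xgetPex.
have [M M0 PM] := is_hpoly_bounded (elimT (hpolyP _ _) (hpoly_funP P)).
apply: (@scalars_supremums _ _ _ M); first exact: norm_set0.
by move=> _ [x x1 <-]; rewrite normr_ge0 PM.
Qed.

Lemma hpoly_norm_ge P x : `|x| <= 1 -> `|P x| <= hpoly_norm P.
Proof. by move=> x1; have [+ _] := hpoly_norm_supremums P; apply; exists x. Qed.

Lemma hpoly_norm_le P M :
  (forall x, `|x| <= 1 -> `|P x| <= M) -> hpoly_norm P <= M.
Proof.
by move=> PM; have [_ +] := hpoly_norm_supremums P; apply => _ [x x1 <-]; exact: PM.
Qed.

Lemma hpoly_norm_ge0 P : 0 <= hpoly_norm P.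
Proof.
by apply: le_trans (@hpoly_norm_ge P 0 _); rewrite ?normr0.
Qed.

Lemma hpoly_normP P x : `|P x| <= hpoly_norm P * `|x| ^+ m.
Proof.
have [->|x0] := eqVneq x 0.
  have [m0|m_gt0] := posnP m.
    by rewrite [X in _ ^+ X]m0 expr0 mulr1; apply: hpoly_norm_ge; rewrite normr0.
  have -> : P 0 = 0 by have := hpolyZ P 0 0; rewrite scale0r expr0n gtn_eqF // scale0r.
  by rewrite !normr0 mulr_ge0 ?exprn_ge0 ?hpoly_norm_ge0.
have nx0 : `|x| != 0 by rewrite normr_eq0.
have {1}-> : x = `|x| *: (`|x|^-1 *: x) by rewrite scalerA divff // scale1r.
rewrite hpolyZ normrZ normrX normr_id mulrC ler_wpM2r ?exprn_ge0 //.
by apply: hpoly_norm_ge; rewrite normrZ normfV normr_id mulVf.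
Qed.

Let hpoly_normD P Q : hpoly_norm (P + Q) <= hpoly_norm P + hpoly_norm Q.
Proof.
apply: hpoly_norm_le => x x1; apply: (le_trans (ler_normD _ _)).
by apply: lerD; exact: hpoly_norm_ge.
Qed.

Let hpoly_normZle a P : hpoly_norm (a *: P) <= `|a| * hpoly_norm P.
Proof.
apply: hpoly_norm_le => x x1.
have -> : (a *: P) x = a *: P x by [].
by rewrite normrZ ler_wpM2l // hpoly_norm_ge.
Qed.

Let hpoly_norm0 P : hpoly_norm P = 0 -> P = 0.
Proof.
move=> P0; apply: val_inj; apply/funext => x /=.
by have := hpoly_normP P x; rewrite P0 mul0r normr_le0 => /eqP.
Qed.

Let hpoly_normZ a P : hpoly_norm (a *: P) = `|a| * hpoly_norm P.
Proof.
apply/eqP; rewrite eq_le hpoly_normZle /=.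
have [->|a0] := eqVneq a 0; first by rewrite normr0 mul0r hpoly_norm_ge0.
rewrite -ler_pdivlMl ?normr_gt0 // -normfV.
have {1}-> : P = a^-1 *: (a *: P) by rewrite scalerA mulVf // scale1r.
exact: hpoly_normZle.
Qed.

HB.instance Definition _ := Lmodule_isNormed.Build K (hpoly m X Y)
  hpoly_normD hpoly_normZ hpoly_norm0.

Lemma hpoly_normE P : `|P| = hpoly_norm P.
Proof. by []. Qed.

(* [hpoly 1 X Y] is the space of continuous linear operators, so this is also
   the approximation number of a linear operator. *)
Definition approx_number (P : hpoly m X Y) (n : nat) : K :=
  infimum 0 [set `|P - Q| | Q in [set Q : hpoly m X Y | rank_lt Q n]].

Lemma has_dim_lin_span0 (V : lmodType K) :
  has_dim (lin_span [set (0 : V)]) 0.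
Proof.
exists (fun=> 0); split=> [[]|c _ []|y [n [c [v [v0 ->]]]]] //.
exists (fun=> 0); rewrite big_ord0 big1 // => i _.
by rewrite (v0 i) scaler0.
Qed.

Lemma approx_number_infimums P n : (0 < n)%N ->
  infimums [set `|P - Q| | Q in [set Q : hpoly m X Y | rank_lt Q n]]
    (approx_number P n).
Proof.
move=> n0; set A := [set _ | _ in _].
have A0 : A !=set0.
  exists `|P - 0|, 0 => //; exists 0%N => //.
  have -> : range (0 : hpoly m X Y) = [set 0].
    by apply/seteqP; split=> [_ [x _ <-]|_ ->] //; exists 0.
  exact: has_dim_lin_span0.
rewrite /approx_number /infimum ifF; last exact/negbTE/set0P.
by apply: xgetPex; apply: scalars_infimums => // _ [Q _ <-].
Qed.

End NormedHPoly.

Definition continuous_dual (R : realType) (k : scalar_kind)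
    (Y : normedModType (scalars R k)) : normedModType (scalars R k) :=
  hpoly 1 Y (scalars R k)^o.

Section Adjoint.
Context (R : realType) (k : scalar_kind) (m : nat).
Local Notation K := (scalars R k).
Context (X Y : normedModType K).

Lemma hpoly1_linear (V W : normedModType K) (T : hpoly 1 V W) : linear T.
Proof.
have /hpolyP [A [linA _ TA]] := hpoly_funP T.
move=> a x y; rewrite !TA.
have E (z : V) : (fun=> z) = set_arg (fun=> 0) (ord0 : 'I_1) z.
  by apply/funext => i; rewrite /set_arg ord1.
by have := linA ord0 (fun=> 0) a x y; rewrite -!E.
Qed.

Lemma linear_bound_continuous (V W : normedModType K) (f : V -> W) (M : K) :
  linear f -> (forall x, `|f x| <= M * `|x|) -> continuous f.
Proof.
move=> linf fM.
pose g := GRing.isLinear.Build K V W *:%R f linf.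
pose F : {linear V -> W} := HB.pack f g.
apply: (@bounded_linear_continuous _ _ _ F).
apply/linear_boundedP.
exists `|M|; split; first exact: normr_real.
move=> r Mr x; apply: (le_trans (fM x)).
have [->|x0] := eqVneq x 0; first by rewrite normr0 !mulr0.
have M0 : 0 <= M.
  by rewrite -(pmulr_lge0 _ (_ : 0 < `|x|)) ?normr_gt0 // (le_trans _ (fM x)).
by rewrite ler_wpM2r // -(ger0_norm M0) ltW.
Qed.

Lemma is_hpoly1 (V W : normedModType K) (f : V -> W) (M : K) :
  linear f -> (forall x, `|f x| <= M * `|x|) -> f \in hpoly_pred 1.
Proof.
move=> linf fM; apply/hpolyP.
have fcts := linear_bound_continuous linf fM.
exists (fun v : {ptws 'I_1 -> V} => f (v ord0)); split.
- by move=> i v a x y; rewrite ord1 /set_arg eqxx linf.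
- move=> v; apply: (continuous_comp _ (fcts _)).
  exact: (@proj_continuous 'I_1 (fun=> V) ord0 v).
- by [].
Qed.

Lemma adjoint_val_subproof (P : hpoly m X Y) (phi : continuous_dual Y) :
  (fun x => phi (P x) : K^o) \in hpoly_pred m.
Proof.
have /hpolyP [A [linA ctsA PA]] := hpoly_funP P.
have linphi := hpoly1_linear phi.
apply/hpolyP; exists (fun v => phi (A v)); split.
- by move=> i v a x y; rewrite linA linphi.
- move=> v; apply: continuous_comp; first exact: ctsA.
  exact: is_hpoly_continuous (elimT (hpolyP _ _) (hpoly_funP phi)) _.
- by move=> x; rewrite PA.
Qed.

Definition adjoint_val (P : hpoly m X Y) (phi : continuous_dual Y) : hpoly m X K^o :=
  HPoly (adjoint_val_subproof P phi).

Lemma adjoint_subproof (P : hpoly m X Y) : adjoint_val P \in hpoly_pred 1.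
Proof.
apply: (@is_hpoly1 _ _ _ `|P|).
  by move=> a phi psi; apply: val_inj.
move=> phi; apply: hpoly_norm_le => x x1 /=.
apply: (le_trans (hpoly_normP _ _)); rewrite expr1 mulrC.
by apply: ler_wpM2r; [exact: hpoly_norm_ge0 | exact: hpoly_norm_ge].
Qed.

Definition adjoint (P : hpoly m X Y) : hpoly 1 (continuous_dual Y) (hpoly m X K^o) :=
  HPoly (adjoint_subproof P).

End Adjoint.

(* Main.v *)
From HB Require Import structures.
Require Import Defs.
From mathcomp Require Import all_boot all_order all_algebra.
From mathcomp Require Import complex ring lra zify finmap.
From mathcomp Require Import all_classical all_reals all_analysis.

Set Implicit Arguments.
Unset Strict Implicit.
Unset Printing Implicit Defensive.

Import Order.TTheory GRing.Theory Num.Theory.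
Import numFieldNormedType.Exports.
Local Open Scope classical_set_scope.
Local Open Scope ring_scope.

(* Let L be an operator of rank < n with |P^* - L| <= a, and write
   L phi = \sum_i g_i(phi) b_i with b_i in P(^m X). The g_i are elements of the
   bidual of Y, and P x is within a of \sum_i b_i(x) g_i there, for x in the unit
   ball. By a Helly type consequence of Hahn-Banach, the g_i can be replaced by
   points s_i of Y as long as only finitely many x are considered, at the price
   of an arbitrarily small error. Take Q x = \sum_i b_i(x) s_i, and one x from
   each piece of a finite partition of the ball on which the b_i are almost
   constant. If P is compact then the pieces can be chosen with small image
   under P and |P - Q| is about a; in general their images have diameter about
   2a and |P - Q| is about 3a. Conversely the adjoint of Q has rank at most the
   rank of Q and |P^* - Q^*| <= |P - Q|. *)

(** * The Hahn-Banach theorem over real and complex scalars *)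

Section RealHahnBanach.
Context (R : realType) (K : numFieldType) (iota : {rmorphism R -> K}).
Context (V : lmodType K).
Implicit Types (p q : V -> R) (x y : V) (t : R).

(** [iota] restricts the scalars to the reals, so real and complex spaces are treated at once.
    Homogeneity is asked only as an inequality, the half that is checked directly for infima;
    [sublinearZ] recovers equality. *)
Definition sublinear q :=
  (forall x y, q (x + y) <= q x + q y) /\
  (forall t x, 0 <= t -> q (iota t *: x) <= t * q x).

Lemma sublinearZ q t x : sublinear q -> 0 <= t -> q (iota t *: x) = t * q x.
Proof.
move=> [qD qZ] t0; apply/eqP; rewrite eq_le qZ //=.
have [->|tn0] := eqVneq t 0.
  by rewrite mul0r; have := qD (iota 0 *: x) 0; rewrite addr0 rmorph0 scale0r; lra.
have tp : 0 < t by rewrite lt_def tn0.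
rewrite -ler_pdivlMl // mulrC.
have {1}-> : x = iota t^-1 *: (iota t *: x).
  by rewrite scalerA -rmorphM mulVf // rmorph1 scale1r.
by rewrite [_ / t]mulrC qZ // invr_ge0.
Qed.

Lemma sublinear0 q : sublinear q -> q 0 = 0.
Proof. by move=> /(@sublinearZ _ 0 0)/(_ (lexx _)); rewrite rmorph0 scale0r mul0r. Qed.

Lemma sublinearN q x : sublinear q -> - q (- x) <= q x.
Proof.
move=> qs; have [qD _] := qs.
by have := qD x (- x); rewrite subrr (sublinear0 qs); lra.
Qed.

(* Below q and still sublinear, but at most - q y at - y. *)
Definition descent q y x : R :=
  inf [set q (x + iota t *: y) - t * q y | t in [set t | 0 <= t]].

(** Subadditivity applied to t y = - x + (x + t y) gives the lower bound - q (- x). *)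
Lemma descent_has_lbound q y x : sublinear q ->
  has_lbound [set q (x + iota t *: y) - t * q y | t in [set t | 0 <= t]].
Proof.
move=> qs; have [qD _] := qs; exists (- q (- x)) => _ [t t0 <-].
have := qD (- x) (x + iota t *: y); rewrite addKr (sublinearZ _ qs t0); lra.
Qed.

Lemma descent_le q y x t : sublinear q -> 0 <= t ->
  descent q y x <= q (x + iota t *: y) - t * q y.
Proof.
by move=> qs t0; apply: ge_inf; [exact: descent_has_lbound | exists t].
Qed.

Lemma descent_ge q y x z :
  (forall t, 0 <= t -> z <= q (x + iota t *: y) - t * q y) ->
  z <= descent q y x.
Proof.
move=> zle; apply: lb_le_inf; last by move=> _ [t t0 <-]; exact: zle.
by exists (q (x + iota 0 *: y) - 0 * q y), 0 => /=.
Qed.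

(** The parameters t for x and t' for x' are combined into t + t' for x + x'; scaling by u turns the
    parameter t into u t. *)
Lemma sublinear_descent q y : sublinear q -> sublinear (descent q y).
Proof.
move=> qs; have [qD qZ] := qs; split=> [x x'|u x u0].
  rewrite -lerBlDr; apply: descent_ge => t t0.
  rewrite lerBlDr [leRHS]addrC -lerBlDr; apply: descent_ge => t' t'0.
  have tt : 0 <= t + t' by rewrite addr_ge0.
  have := descent_le y (x + x') qs tt.
  have := qD (x + iota t *: y) (x' + iota t' *: y).
  rewrite addrACA -scalerDl -rmorphD; lra.
have [->|un0] := eqVneq u 0.
  rewrite rmorph0 scale0r mul0r; have := descent_le y 0 qs (lexx 0).
  by rewrite rmorph0 scale0r addr0 (sublinear0 qs); lra.
have up : 0 < u by rewrite lt_def un0.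
rewrite mulrC -ler_pdivrMr //; apply: descent_ge => t t0.
have ut : 0 <= u * t by rewrite mulr_ge0.
rewrite ler_pdivrMr //; apply: (le_trans (descent_le _ _ qs ut)).
have -> : iota u *: x + iota (u * t) *: y = iota u *: (x + iota t *: y).
  by rewrite scalerDr scalerA rmorphM.
by rewrite sublinearZ // mulrBl; lra.
Qed.

(** Zorn's lemma for the reversed pointwise order: the infimum of a chain is again sublinear, and it
    is finite because every member s satisfies - p (- x) <= s x. *)
Lemma minimal_sublinear p : sublinear p -> exists2 q,
  sublinear q /\ (forall x, q x <= p x) &
  forall q', sublinear q' -> (forall x, q' x <= q x) -> forall x, q x <= q' x.
Proof.
move=> ps; pose T := {q | sublinear q /\ forall x, q x <= p x}.
pose le_T (q q' : T) := `[< forall x, sval q' x <= sval q x >].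
have [|||[q [qs qp]] qmin] := @ZL_preorder T (exist _ p (conj ps (fun=> lexx _))) le_T.
- by move=> q; apply/asboolP => x.
- by move=> q q' q'' /asboolP h /asboolP h'; apply/asboolP => x; apply: le_trans (h' x) (h x).
- move=> A Atot; have [[a Aa]|A0] := pselect (A !=set0); last first.
    by exists (exist _ p (conj ps (fun=> lexx _))) => s As; case: A0; exists s.
  pose v x := [set sval s x | s in A].
  have vlb x : has_lbound (v x).
    exists (- p (- x)) => _ [[s [ss sp]] As <-] /=.
    by apply: le_trans (sublinearN _ ss); rewrite lerN2.
  pose w x := inf (v x).
  have wle s x : A s -> w x <= sval s x by move=> As; apply: ge_inf => //; exists s.
  have wge z x : (forall s, A s -> z <= sval s x) -> z <= w x.
    move=> zs; apply: lb_le_inf; first by exists (sval a x), a.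
    by move=> _ [s As <-]; exact: zs.
  have ws : sublinear w.
    split=> [x y|t x t0].
      rewrite -lerBlDr; apply: (wge) => s As.
      rewrite lerBlDr [leRHS]addrC -lerBlDr; apply: (wge) => s' As'.
      (* The smaller of the two members s and s' of the chain bounds w (x + y). *)
      have [/asboolP ss'|/asboolP ss'] := Atot _ _ As As'.
        have [+ _] := (svalP s').1 => /(_ x y).
        by have := wle _ (x + y) As'; have := ss' x; lra.
      have [+ _] := (svalP s).1 => /(_ x y).
      by have := wle _ (x + y) As; have := ss' y; lra.
    have [->|tn0] := eqVneq t 0.
      rewrite rmorph0 scale0r mul0r; apply: le_trans (wle _ _ Aa) _.
      by rewrite (sublinear0 (svalP a).1).
    have tp : 0 < t by rewrite lt_def tn0.
    rewrite mulrC -ler_pdivrMr //; apply: (wge) => s As.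
    rewrite ler_pdivrMr //; apply: (le_trans (wle _ _ As)).
    by rewrite mulrC; apply: (svalP s).1.2.
  have wp x : w x <= p x by apply: le_trans (wle _ _ Aa) ((svalP a).2 x).
  by exists (exist _ w (conj ws wp)) => s As; apply/asboolP => x; exact: wle.
exists q => // q' q's q'q x.
have q'p y : q' y <= p y by apply: le_trans (q'q y) (qp y).
have /qmin/asboolP : le_T (exist _ q (conj qs qp)) (exist _ q' (conj q's q'p)).
  exact/asboolP.
exact.
Qed.

(* A minimal sublinear functional q is linear: descent q y is sublinear and
   below q, hence equal to q, so that q x <= q (x + y) - q y. *)
Theorem hahn_banach_real p x0 : sublinear p -> exists f : V -> R,
  [/\ forall x y, f (x + y) = f x + f y,
      forall t x, f (iota t *: x) = t * f x,
      forall x, f x <= p x & f x0 = p x0].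
Proof.
(* Minimising below [descent p x0] rather than below p forces f (- x0) <= - p x0, whence f x0 = p
   x0. *)
move=> ps; have ds := sublinear_descent x0 ps.
have [f [fs fd] fmin] := minimal_sublinear ds.
have fD x y : f (x + y) = f x + f y.
  apply/eqP; rewrite eq_le fs.1 /=.
  have /(fmin _ (sublinear_descent y fs))/(_ x) : forall z, descent f y z <= f z.
    move=> z; have := descent_le y z fs (lexx 0).
    by rewrite rmorph0 scale0r addr0 mul0r subr0.
  have := descent_le y x fs ler01; rewrite rmorph1 scale1r mul1r; lra.
have fN x : f (- x) = - f x.
  by have := fD x (- x); rewrite subrr (sublinear0 fs); lra.
have dp x : descent p x0 x <= p x.
  by have := descent_le x0 x ps (lexx 0); rewrite rmorph0 scale0r addr0 mul0r subr0.
exists f; split=> //.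
- move=> t x; have [t0|/ltW t0] := leP 0 t; first exact: sublinearZ.
  have := @sublinearZ f (- t) x fs; rewrite oppr_ge0 => /(_ t0).
  by rewrite rmorphN scaleNr fN; lra.
- by move=> x; apply: le_trans (fd x) (dp x).
- apply/eqP; rewrite eq_le (le_trans (fd x0) (dp x0)) /=.
  have := fd (- x0); have := descent_le x0 (- x0) ps ler01.
  by rewrite rmorph1 scale1r addNr (sublinear0 ps) fN; lra.
Qed.

End RealHahnBanach.

Section ScalarHahnBanach.
Context (R : realType).

Lemma complex_ge0E (z : R[i]) : 0 <= z -> z = (complex.Re z)%:C%C.
Proof. by case: z => a b; rewrite lecE /= => /andP[/eqP -> _]. Qed.

(** A complex linear functional is recovered from its real part g as g x - i g (i x). Multiplying x
    by a scalar u of modulus 1 that makes the value real and nonnegative turns the bound on g into a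
    bound on the modulus. *)
Lemma hahn_banach_complex (V : lmodType R[i]) (p : V -> R[i]) (x0 : V) :
  (forall x y, p (x + y) <= p x + p y) ->
  (forall a x, p (a *: x) = `|a| * p x) ->
  exists2 f : {linear V -> R[i]^o},
    forall x, `|f x| <= p x & p x0 <= `|f x0|.
Proof.
move=> pD pZ.
have p_ge0 x : 0 <= p x.
  have := pD x (- x); rewrite subrr -scaleN1r pZ normrN1 mul1r.
  have -> : p 0 = 0 by rewrite -(scale0r (0 : V)) pZ normr0 mul0r.
  by rewrite -mulr2n pmulrn_lge0.
pose q x := complex.Re (p x).
have pq x : p x = (q x)%:C%C by rewrite {1}(complex_ge0E (p_ge0 x)).
have qs : sublinear (real_complex R) q.
  split=> [x y|t x t0].
    by have := pD x y; rewrite !pq lecE => /andP[_].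
  by rewrite /q pZ ger0_norm ?lecR // pq /= mul0r subr0.
have [g [gD gZ gq g0]] := hahn_banach_real x0 qs.
pose F (x : V) : R[i]^o := (g x -i* g ('i%C *: x))%C.
have gN x : g (- x) = - g x.
  by have := gZ (-1) x; rewrite rmorphN rmorph1 scaleN1r mulN1r.
have FL : linear F.
  move=> [u v] x y.
  have -> : (u +i* v)%C = u%:C%C + v%:C%C * 'i%C.
    by apply/eqP; rewrite eq_complex /=; apply/andP; split; apply/eqP; ring.
  have ii : 'i%C * 'i%C = -1 :> R[i] by rewrite -expr2 sqr_i.
  have -> : F ((u%:C%C + v%:C%C * 'i%C) *: x + y) =
      ((u * g x + v * g ('i%C *: x) + g y)
        -i* (u * g ('i%C *: x) - v * g x + g ('i%C *: y)))%C.
    rewrite /F; congr (_ -i* _)%C.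
      by rewrite gD scalerDl gD -scalerA !gZ.
    rewrite scalerDr gD scalerA mulrDr mulrCA ii mulrN1 mulrC.
    by rewrite scalerDl gD scaleNr gN -scalerA !gZ.
  by apply/eqP; rewrite eq_complex /=; apply/andP; split; apply/eqP; ring.
pose G : {linear V -> R[i]^o} := HB.pack F (GRing.isLinear.Build _ _ _ _ F FL).
exists G => [x|].
  have [->|Gx0] := eqVneq (G x) 0; first by rewrite normr0.
  pose u := `|G x| / G x.
  have u1 : `|u| = 1 by rewrite normrM normfV normr_id divff // normr_eq0.
  have Gu : G (u *: x) = `|G x| by rewrite linearZ /= /u [_ *: _]divfK.
  have : g (u *: x) = complex.Re `|G x| by rewrite -Gu.
  have := gq (u *: x); rewrite /q pZ u1 mul1r => + guE; rewrite guE => h.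
  by rewrite [leLHS]complex_ge0E // pq lecR.
apply: le_trans (normc_ge_Re _); rewrite pq lecR.
by rewrite /= g0 ler_norm.
Qed.

Lemma hahn_banach (k : scalar_kind) (V : lmodType (scalars R k))
    (p : V -> scalars R k) (x0 : V) :
  (forall x y, p (x + y) <= p x + p y) ->
  (forall a x, p (a *: x) = `|a| * p x) ->
  exists2 f : {linear V -> (scalars R k)^o},
    forall x, `|f x| <= p x & p x0 <= `|f x0|.
Proof.
case: k V p x0 => /= V p x0; last exact: hahn_banach_complex.
move=> pD pZ.
have ps : sublinear (idfun : R -> R) p.
  by split=> // t x t0; rewrite pZ ger0_norm.
have [f [fD fZ fp f0]] := hahn_banach_real x0 ps.
have fL : linear (f : V -> R^o) by move=> a x y; rewrite fD fZ.
pose G : {linear V -> R^o} := HB.pack (f : V -> R^o) (GRing.isLinear.Build _ _ _ _ (f : V -> R^o) fL).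
exists G => [x|] /=.
  rewrite ler_norml fp andbT lerNl.
  have <- : f (- x) = - f x.
    by have := fZ (-1) x; rewrite /= scaleN1r mulN1r.
  by apply: le_trans (fp _) _; rewrite -scaleN1r pZ normrN1 mul1r.
by rewrite f0 ler_norm.
Qed.

End ScalarHahnBanach.

(** * A Helly type theorem *)

(** By induction, c minus the sum of the remaining s i is an upper bound of the first set, hence at
    least its s i. This avoids approximating suprema up to an error. *)
Lemma sum_lub_ord (K : numDomainType) n (A : 'I_n -> set K) (s : 'I_n -> K) (c : K) :
  (forall i, lbound (ubound (A i)) (s i)) ->
  (forall t, (forall i, A i (t i)) -> \sum_i t i <= c) -> \sum_i s i <= c.
Proof.
elim: n A s c => [|n IHn] A s c As tc.
  by have := tc s; rewrite !big_ord0; apply; case.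
rewrite big_ord_recl -lerBrDr; apply: (As ord0) => x Ax.
rewrite lerBrDr -lerBrDl; apply: (IHn (fun i => A (lift ord0 i))) => // t At.
pose t' i := if unlift ord0 i is Some j then t j else x.
have := tc t'; rewrite big_ord_recl /t' unlift_none lerBrDl.
under eq_bigr do rewrite liftK.
apply=> i; case: unliftP => [j ->|->] //.
Qed.

Lemma sum_lub (K : numDomainType) (I : finType) (A : I -> set K) (s : I -> K) (c : K) :
  (forall i, lbound (ubound (A i)) (s i)) ->
  (forall t, (forall i, A i (t i)) -> \sum_i t i <= c) -> \sum_i s i <= c.
Proof.
move=> As tc; pose h : 'I_#|I| -> I := enum_val.
have hb : {on predT, bijective h}.
  by exists enum_rank => i _; [exact: enum_valK | exact: enum_rankK].
rewrite (reindex h) //=.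
apply: (sum_lub_ord (A := A \o h)) => [i|t At]; first exact: As.
have := tc (t \o enum_rank); rewrite (reindex h) //=.
under eq_bigr do rewrite enum_valK.
by apply=> i /=; have := At (enum_rank i); rewrite /= /h enum_rankK.
Qed.

Section Single.
Context (K : pzRingType) (V : lmodType K) (J : finType).

Definition single (l : J) (y : V) : J -> V := fun j => if j == l then y else 0.

Lemma single_linear l : linear (single l).
Proof.
move=> a x y; apply/funext => j; rewrite /single !fctE.
by case: eqP => // _; rewrite scaler0 addr0.
Qed.

Lemma sum_single (v : J -> V) : v = \sum_l single l (v l).
Proof.
apply/funext => j; rewrite fct_sumE (bigD1 j) //= /single eqxx.
by rewrite big1 ?addr0 // => l; rewrite eq_sym => /negbTE ->.
Qed.

Lemma sumZ_single (c : J -> K) i y : \sum_j c j *: single i y j = c i *: y.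
Proof.
rewrite (bigD1 i) //= /single eqxx big1 ?addr0 // => j /negbTE ->.
exact: scaler0.
Qed.

End Single.

Lemma hpoly_sumE (K : numFieldType) m (X Y : normedModType K) (I : finType)
  (P : I -> hpoly m X Y) x : (\sum_i P i) x = \sum_i P i x.
Proof. by apply: (big_morph (fun Q : hpoly m X Y => Q x)). Qed.

Section Helly.
Context (R : realType) (k : scalar_kind).
Local Notation K := (scalars R k).

Lemma infimum_scalars (A : set K) : A !=set0 -> (forall x, A x -> 0 <= x) ->
  infimums A (infimum 0 A).
Proof.
move=> A0 Age0; rewrite /infimum ifF; last exact/negbTE/set0P.
by apply: xgetPex; exact: scalars_infimums.
Qed.

(** Otherwise the infimum plus e would be a lower bound. Elements of K need not be comparable, but
    nonnegative ones are. *)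
Lemma infimum_lt (A : set K) e : A !=set0 -> (forall x, A x -> 0 <= x) ->
  0 < e -> exists2 x, A x & x < infimum 0 A + e.
Proof.
move=> A0 Age0 e0; have [infA Ainf] := infimum_scalars A0 Age0.
have inf_ge0 : 0 <= infimum 0 A by apply: (Ainf) => y; exact: Age0.
apply: contrapT => noA; suff : infimum 0 A + e <= infimum 0 A.
  by rewrite gerDl lt_geF.
apply: Ainf => x Ax.
rewrite real_leNgt; first by apply/negP => xlt; apply: noA; exists x.
  by rewrite ger0_real // addr_ge0 // ltW.
by rewrite ger0_real // Age0.
Qed.

Context (Y : normedModType K) (L I : finType).

Lemma hpoly_norm_sup (phi : continuous_dual Y) :
  lbound (ubound [set `|phi y| | y in [set y : Y | `|y| <= 1]]) `|phi|.
Proof. by have [] := hpoly_norm_supremums phi. Qed.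

Lemma unit_rotation (z : K) : exists2 u : K, `|u| = 1 & u * z = `|z|.
Proof.
have [->|z0] := eqVneq z 0; first by exists 1; rewrite ?normr1 ?normr0 ?mulr0.
exists (`|z| / z); last by rewrite divfK.
by rewrite normrM normfV normr_id divff // normr_eq0.
Qed.

Context (c : L -> I -> K).

(* [dist] is the distance in l_infinity(L; Y) to the subspace of the vectors
   (\sum_i c l i *: s i)_l. *)
Definition dist_set (v : L -> Y) : set K := [set b | 0 <= b /\
  exists s : I -> Y, forall l, `|v l - \sum_i c l i *: s i| <= b].

Lemma dist_set_neq0 v : dist_set v !=set0.
Proof.
exists (\sum_l `|v l|); split; first exact: sumr_ge0.
exists (fun=> 0) => l; rewrite big1 ?subr0 => [|i _]; last exact: scaler0.
by rewrite (bigD1 l) //= lerDl sumr_ge0.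
Qed.

Lemma dist_set_ge0 v b : dist_set v b -> 0 <= b. Proof. by case. Qed.

Definition dist (v : L -> Y) : K := infimum 0 (dist_set v).

Lemma dist_infimums v : infimums (dist_set v) (dist v).
Proof. by apply: infimum_scalars; [exact: dist_set_neq0 | exact: dist_set_ge0]. Qed.

Lemma dist_le v b : 0 <= b ->
  (exists s : I -> Y, forall l, `|v l - \sum_i c l i *: s i| <= b) -> dist v <= b.
Proof. by move=> b0 vb; have [+ _] := dist_infimums v; apply. Qed.

Lemma dist_ge0 v : 0 <= dist v.
Proof. by have [_ +] := dist_infimums v; apply => b; exact: dist_set_ge0. Qed.

Lemma distD v w : dist (v + w) <= dist v + dist w.
Proof.
rewrite -lerBlDr; have [_ +] := dist_infimums v; apply => b [b0 [s sb]].
rewrite lerBlDl -lerBlDr; have [_ +] := dist_infimums w; apply => b' [b'0 [s' sb']].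
rewrite lerBlDr; apply: dist_le; first exact: addr_ge0.
exists (s + s') => l.
have -> : (v + w) l - \sum_i c l i *: (s + s') i =
    (w l - \sum_i c l i *: s' i) + (v l - \sum_i c l i *: s i).
  rewrite addrACA -opprD -big_split /= [w l + _]addrC; congr (_ - _).
  by apply: eq_bigr => i _; rewrite -scalerDr [s' i + _]addrC.
by apply: le_trans (ler_normD _ _) _; apply: lerD.
Qed.

Lemma distZ_le a v : dist (a *: v) <= `|a| * dist v.
Proof.
have [->|a0] := eqVneq a 0.
  rewrite normr0 mul0r; apply: dist_le => //; exists (fun=> 0) => l.
  rewrite scale0r big1 ?subr0 ?normr0 // => i _; exact: scaler0.
rewrite -ler_pdivrMl ?normr_gt0 //.
have [_ +] := dist_infimums v; apply => b [b0 [s sb]].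
rewrite ler_pdivrMl ?normr_gt0 //; apply: dist_le; first exact: mulr_ge0.
exists (fun i => a *: s i) => l.
have -> : (a *: v) l - \sum_i c l i *: (a *: s i) = a *: (v l - \sum_i c l i *: s i).
  rewrite scalerBr scaler_sumr; congr (_ - _).
  by apply: eq_bigr => i _; rewrite !scalerA mulrC.
by rewrite normrZ ler_wpM2l.
Qed.

Lemma distZ a v : dist (a *: v) = `|a| * dist v.
Proof.
apply/eqP; rewrite eq_le distZ_le /=.
have [->|a0] := eqVneq a 0; first by rewrite normr0 mul0r dist_ge0.
rewrite -ler_pdivlMl ?normr_gt0 // -normfV.
have {1}-> : v = a^-1 *: (a *: v) by rewrite scalerA mulVf // scale1r.
exact: distZ_le.
Qed.

Lemma dist_single l y : dist (single l y) <= `|y|.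
Proof.
apply: dist_le => //; exists (fun=> 0) => j.
rewrite big1 ?subr0 => [|i _]; last exact: scaler0.
by rewrite /single; case: eqP => // _; rewrite normr0.
Qed.

Lemma dist_range0 (s : I -> Y) : dist (fun l => \sum_i c l i *: s i) <= 0.
Proof. by apply: dist_le => //; exists s => l; rewrite subrr normr0. Qed.

(* The functional given by Hahn-Banach for [dist] is a family phi of elements
   of the dual with sum of norms at most 1 and \sum_l c l i *: phi l = 0, so
   that \sum_l phi l (p l) does not change when the sums of the g i are
   subtracted. *)
Theorem helly (p : L -> Y) (g : I -> {linear continuous_dual Y -> K^o}) (a e : K) :
  0 <= a -> 0 < e ->
  (forall l (phi : continuous_dual Y),
     `|phi (p l) - \sum_i c l i * g i phi| <= a * `|phi|) ->
  exists s : I -> Y, forall l, `|p l - \sum_i c l i *: s i| <= a + e.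
Proof.
move=> a0 e0 pga.
suff pa : dist p <= a.
  have [b [_ [s sb]] blt] :=
    infimum_lt (dist_set_neq0 p) (@dist_set_ge0 p) e0.
  exists s => l; apply: le_trans (sb l) _; apply: le_trans (ltW blt) _.
  by rewrite lerD2r.
have [f fle pf] := hahn_banach p distD distZ.
apply: (le_trans pf).
pose phi0 l y : K^o := f (single l y).
have phiP l : phi0 l \in hpoly_pred 1.
  apply: (is_hpoly1 (M := 1)) => [b x y|y].
    by rewrite /phi0 single_linear linearP.
  by rewrite mul1r; apply: le_trans (fle _) _; exact: dist_single.
pose phi l : continuous_dual Y := HPoly (phiP l).
have fE v : f v = \sum_l phi l (v l).
  by rewrite {1}(sum_single v) linear_sum.
(* Rotating points of the unit ball makes each phi l (y l) equal to its modulus. The sum of these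
   values is f y, and f y <= dist y <= 1 since s = 0 competes in the distance. *)
have phi1 : \sum_l `|phi l| <= 1.
  apply: (sum_lub (fun l => @hpoly_norm_sup (phi l))) => t tP.
  have /choice [y yP] : forall l, exists y : Y, `|y| <= 1 /\ phi l y = t l.
    move=> l; have [y y1 yt] := tP l.
    have [u u1 uz] := unit_rotation (phi l y).
    exists (u *: y); rewrite normrZ u1 mul1r; split=> //.
    by rewrite hpolyZ expr1; exact: etrans uz yt.
  have -> : \sum_l t l = f y by rewrite fE; apply: eq_bigr => l _; rewrite (yP l).2.
  have t0 : 0 <= f y.
    rewrite fE sumr_ge0 // => l _; rewrite (yP l).2.
    by have [z _ <-] := tP l.
  rewrite -(ger0_norm t0); apply: le_trans (fle _) _; apply: dist_le => //.
  exists (fun=> 0) => l; rewrite big1 ?subr0 ?(yP l).1 // => i _; exact: scaler0.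
(* f vanishes on the subspace because [dist] does; the test vectors have s concentrated at the index
   i. *)
have c0 i : \sum_l c l i *: phi l = 0.
  apply: val_inj; apply/funext => y; rewrite /= hpoly_sumE.
  transitivity (f (fun l => \sum_j c l j *: single i y j)).
    rewrite fE; apply: eq_bigr => l _.
    by rewrite sumZ_single hpolyZ expr1.
  apply/eqP; rewrite -normr_le0; apply: le_trans (fle _) _.
  exact: dist_range0.
have -> : f p = \sum_l (phi l (p l) - \sum_i c l i * g i (phi l)).
  rewrite fE sumrB [X in _ - X]exchange_big /= [X in _ - X]big1 ?subr0 // => i _.
  transitivity (g i (\sum_l c l i *: phi l)); last by rewrite c0 linear0.
  by rewrite linear_sum; apply: eq_bigr => l _; rewrite linearZ.
apply: le_trans (ler_norm_sum _ _ _) _.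
apply: (@le_trans _ _ (\sum_l a * `|phi l|)); first exact: ler_sum.
by rewrite -mulr_sumr ler_piMr.
Qed.

End Helly.

(** * Linear independence and rank *)

Lemma kernel_vector (K : fieldType) k d (A : 'I_k -> 'I_d -> K) : (d < k)%N ->
  exists2 c : 'I_k -> K, exists i, c i != 0 & forall l, \sum_j c j * A j l = 0.
Proof.
move=> dk; pose M := \matrix_(i, j) A i j.
have /rowV0Pn [v /sub_kermxP vM /rV0Pn [i vi]] : kermx M != 0.
  rewrite kermx_eq0 /row_free neq_ltn; apply/orP; left.
  exact: leq_ltn_trans (rank_leq_col _) dk.
exists (v 0); first by exists i.
move=> l; have /rowP/(_ l) := vM; rewrite !mxE => vMl.
by rewrite -[RHS]vMl; apply: eq_bigr => j _; rewrite mxE.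
Qed.

Definition lin_indep (K : pzRingType) (V : lmodType K) k (b : 'I_k -> V) :=
  forall c : 'I_k -> K, \sum_i c i *: b i = 0 -> forall i, c i = 0.

(** An independent family of maximal length is a basis: adjoining y creates a relation, and the
    coefficient of y in it is nonzero by independence of the others. *)
Lemma has_dim_le (K : numFieldType) (V : lmodType K) (S : set V) d :
  (forall k (b : 'I_k -> V), (forall i, lin_span S (b i)) -> lin_indep b ->
    (k <= d)%N) ->
  exists2 d', (d' <= d)%N & has_dim (lin_span S) d'.
Proof.
move=> Sd.
pose P k := `[< exists2 b : 'I_k -> V, forall i, lin_span S (b i) & lin_indep b >].
have exP : exists k, P k.
  by exists 0%N; apply/asboolP; exists (fun=> 0) => [[]|c _ []].
have Pd k : P k -> (k <= d)%N by move=> /asboolP [b bS bi]; exact: Sd bS bi.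
case: (ex_maxnP exP Pd) => d' Pd' d'max; exists d'; first exact: Pd.
have /asboolP [b bS bi] := Pd'; exists b; split=> // y yS.
pose b' i := if unlift ord0 i is Some j then b j else y.
have : ~ lin_indep b'.
  move=> b'i; have /d'max : P d'.+1; last by rewrite ltnn.
  by apply/asboolP; exists b' => // i; rewrite /b'; case: unlift.
move=> /existsNP [c] /not_implyP [c0] /existsNP [i0 /eqP ci0].
move: c0; rewrite big_ord_recl /b' unlift_none.
under eq_bigr do rewrite liftK.
move=> c0; have [c00|c00] := eqVneq (c ord0) 0.
  move: c0; rewrite c00 scale0r add0r => /bi cb.
  by case: (unliftP ord0 i0) ci0 => [j ->|->]; rewrite ?cb ?c00 eqxx.
exists (fun i => - (c ord0)^-1 * c (lift ord0 i)).
under eq_bigr do rewrite -scalerA.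
rewrite -scaler_sumr; move/eqP: c0; rewrite addrC addr_eq0 => /eqP ->.
by rewrite scalerN scaleNr opprK scalerA mulVf // scale1r.
Qed.

Lemma lin_indep_le (K : numFieldType) (V : lmodType K) (S : set V) d (s : 'I_d -> V) k
    (b : 'I_k -> V) :
  (forall y, S y -> exists c : 'I_d -> K, y = \sum_i c i *: s i) ->
  (forall i, lin_span S (b i)) -> lin_indep b -> (k <= d)%N.
Proof.
move=> Ss bS bi; rewrite leqNgt; apply/negP => dk.
have /choice [A bA] : forall i, exists c : 'I_d -> K, b i = \sum_i c i *: s i.
  move=> i; have [n [c [v [vS ->]]]] := bS i.
  have /choice [B vB] := fun j => Ss _ (vS j).
  exists (fun l => \sum_j c j * B j l).
  under eq_bigr do rewrite vB scaler_sumr.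
  rewrite exchange_big /=; apply: eq_bigr => l _.
  by rewrite scaler_suml; apply: eq_bigr => j _; rewrite scalerA.
have [c [i ci] cA] := kernel_vector A dk.
suff /bi/(_ i) c0 : \sum_j c j *: b j = 0 by rewrite c0 eqxx in ci.
under eq_bigr do rewrite bA scaler_sumr.
rewrite exchange_big big1 //= => l _.
by under eq_bigr do rewrite scalerA; rewrite -scaler_suml cA scale0r.
Qed.

Lemma rank_lt_span (K : numFieldType) m (X Y : normedModType K) (P : hpoly m X Y)
    d n (s : 'I_d -> Y) : (d < n)%N ->
  (forall x, exists c : 'I_d -> K, P x = \sum_i c i *: s i) -> rank_lt P n.
Proof.
move=> dn Ps.
have [k b bS bi|d' d'd Pd'] := @has_dim_le _ _ (range P) d; last first.
  by exists d' => //; exact: leq_ltn_trans d'd dn.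
by apply: (lin_indep_le (s := s)) bS bi => _ [x _ <-].
Qed.

(* Evaluation points are added until they separate the span of b; the
   coordinates are then linear combinations of these evaluations. *)
Lemma coord_eval (K : fieldType) (X : Type) (d : nat) (b : 'I_d -> X -> K) :
  (forall c : 'I_d -> K, (forall x, \sum_i c i * b i x = 0) -> forall i, c i = 0) ->
  exists N (x : 'I_N -> X) (W : 'I_N -> 'I_d -> K),
    forall c i, \sum_j (\sum_l c l * b l (x j)) * W j i = c i.
Proof.
move=> bi; pose M N (x : 'I_N -> X) := \matrix_(i, j) b i (x j).
have rk k : (k <= d)%N -> exists N (x : 'I_N -> X), (k <= \rank (M N x))%N.
  elim: k => [_|k IHk kd].
    by exists 0%N; exists (fun i : 'I_0 => False_rect X (notF (ltn_ord i))).
  have [N [x kx]] := IHk (ltnW kd).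
  have [kx'|xk] := ltnP k (\rank (M N x)); first by exists N, x.
  have /rowV0Pn [v vM v0] : kermx (M N x) != 0.
    rewrite kermx_eq0 /row_free neq_ltn; apply/orP; left.
    exact: leq_ltn_trans xk kd.
  have [y vy] : exists y, \sum_i v 0 i * b i y != 0.
    apply: contrapT => noy; move/negP: v0; apply; apply/eqP/rowP => i.
    rewrite mxE; apply: (bi (v 0)) => y; apply: contrapT => vy.
    by apply: noy; exists y; apply/eqP.
  pose x' (i : 'I_(N + 1)) := if fintype.split i is inl j then x j else y.
  exists (N + 1)%N, x'.
  have ME : M _ x' = row_mx (M N x) (\col_i b i y).
    apply/matrixP => i j; rewrite !mxE /x'.
    by case: splitP => l _; rewrite mxE.
  (* The vector v lies in the old left kernel but not in the new one, so the kernel shrinks and the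
     rank grows. *)
  have lt_ker : (kermx (M _ x') < kermx (M N x))%MS.
    rewrite /ltmx; apply/andP; split.
      apply/sub_kermxP; have := mulmx_ker (M _ x').
      by rewrite {2}ME mul_mx_row -row_mx0 => /eq_row_mx [].
    apply/negP => /(submx_trans vM)/sub_kermxP.
    rewrite ME mul_mx_row -row_mx0 => /eq_row_mx [_ /rowP/(_ 0)].
    rewrite !mxE => vy0; move/negP: vy; apply; apply/eqP.
    by rewrite -[RHS]vy0; apply: eq_bigr => i _; rewrite !mxE.
  have := rank_ltmx lt_ker; rewrite !mxrank_ker.
  have := rank_leq_row (M _ x'); have := rank_leq_row (M N x); lia.
have [N [x dx]] := rk d (leqnn d).
have Mfree : row_free (M N x) by rewrite /row_free eqn_leq rank_leq_row.
(* Full row rank makes the pseudo-inverse a right inverse. *)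
exists N, x, (fun j i => pinvmx (M N x) j i) => c i.
have /rowP/(_ i) := mulmxKp Mfree (\row_l c l).
rewrite !mxE => <-; apply: eq_bigr => j _; rewrite !mxE; congr (_ * _).
by apply: eq_bigr => l _; rewrite !mxE.
Qed.

(** * Totally bounded maps *)

(** The pieces of the finite partition are the fibres of h. Partitions for several maps then combine
    by taking tuples of labels. *)
Definition totally_bounded_on (K : numFieldType) (X : Type) (S : set X)
    (Y : normedModType K) (f : X -> Y) :=
  forall e : K, 0 < e -> exists (T : finType) (h : X -> T),
    forall x y, S x -> S y -> h x = h y -> `|f x - f y| <= e.

Lemma totally_bounded_family (K : numFieldType) (X : Type) (S : set X)
    (Y : normedModType K) (I : finType) (f : I -> X -> Y) (e : K) : 0 < e ->
  (forall i, totally_bounded_on S (f i)) -> exists (T : finType) (h : X -> T),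
    forall x y, S x -> S y -> h x = h y -> forall i, `|f i x - f i y| <= e.
Proof.
move=> e0 fS.
have /choice [F FP] : forall i, exists Th : {T : finType & X -> T},
    forall x y, S x -> S y -> projT2 Th x = projT2 Th y -> `|f i x - f i y| <= e.
  by move=> i; have [T [h hP]] := fS i e e0; exists (existT _ T h).
exists {dffun forall i, projT1 (F i)}, (fun x => [ffun i => projT2 (F i) x]).
move=> x y Sx Sy hxy i; apply: FP => //.
by have := congr1 (fun g : {dffun forall i, projT1 (F i)} => g i) hxy; rewrite !ffunE.
Qed.

Lemma bounded_labels (R : realType) (X : Type) (S : set X) (f : X -> R) (M e : R) :
  0 < e -> (forall x, S x -> `|f x| <= M) -> exists (T : finType) (h : X -> T),
    forall x y, S x -> S y -> h x = h y -> `|f x - f y| <= e.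
Proof.
move=> e0 fM; pose t x := (f x + M) / e.
(* On S, t takes values between 0 and 2M / e, so its integer part is one of 0, ..., N. Equal integer
   parts mean that t differs by less than 1, hence f by less than e. *)
pose N := Num.truncn ((M + M) / e).
exists 'I_N.+1, (fun x => inord (Num.truncn (t x))) => x y Sx Sy.
have tP z : S z -> 0 <= t z /\ (Num.truncn (t z) < N.+1)%N.
  move=> /fM; rewrite ler_norml => /andP[fl fr]; split.
    by rewrite divr_ge0 ?(ltW e0) //; lra.
  by rewrite ltnS; apply: le_truncn; rewrite ler_pM2r ?invr_gt0 // lerD2r.
have [[tx xN] [ty yN]] := (tP _ Sx, tP _ Sy).
move=> /(congr1 val); rewrite /= !inordK // => txy.
have := truncn_itv tx; have := truncn_itv ty; rewrite txy.
move=> /andP[y1 y2] /andP[x1 x2].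
have -> : f x - f y = (t x - t y) * e.
  by rewrite /t; field; rewrite gt_eqF.
rewrite normrM (gtr0_norm e0) ger_pMl // ler_norml.
by move: x1 x2 y1 y2; rewrite -natr1; lra.
Qed.

Lemma normc_real (R : realType) (r : R) : `|r%:C%C| = `|r|%:C%C :> R[i].
Proof. by rewrite normc_def /= expr0n addr0 sqrtr_sqr. Qed.

Lemma normc_ge_Im (R : realType) (z : R[i]) : `|complex.Im z|%:C%C <= `|z|.
Proof.
have := normc_ge_Re (z * 'i%C).
by rewrite normrM ReiNIm normrN complexiE normCi mulr1.
Qed.

Lemma normc_le (R : realType) (z : R[i]) :
  `|z| <= (`|complex.Re z| + `|complex.Im z|)%:C%C.
Proof.
rewrite {1}[z]complexE rmorphD; apply: le_trans (ler_normD _ _) _.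
by rewrite normrM complexiE normCi mul1r !normc_real.
Qed.

(** In the complex case the real and imaginary parts are labelled separately, each with accuracy e /
    2. *)
Lemma totally_bounded_scalar (R : realType) (k : scalar_kind) (X : Type) (S : set X)
    (f : X -> (scalars R k)^o) M :
  (forall x, S x -> `|f x| <= M) -> totally_bounded_on S f.
Proof.
case: k f M => /= f M fM e e0; first exact: bounded_labels e0 fM.
have eE := complex_ge0E (ltW e0).
have e2 : 0 < complex.Re e / 2 by move: e0; rewrite eE ltcR; lra.
have [T [h hP]] : exists (T : finType) (h : X -> T), forall x y, S x -> S y -> h x = h y ->
    `|complex.Re (f x) - complex.Re (f y)| <= complex.Re e / 2.
  apply: (bounded_labels (M := complex.Re M)) => // x /fM fxM.
  have := le_trans (normc_ge_Re _) fxM.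
  by rewrite lecE => /andP[].
have [T' [h' hP']] : exists (T : finType) (h : X -> T), forall x y, S x -> S y -> h x = h y ->
    `|complex.Im (f x) - complex.Im (f y)| <= complex.Re e / 2.
  apply: (bounded_labels (M := complex.Re M)) => // x /fM fxM.
  have := le_trans (normc_ge_Im _) fxM.
  by rewrite lecE => /andP[].
exists (T * T')%type, (fun x => (h x, h' x)) => x y Sx Sy [hxy hxy'].
apply: le_trans (normc_le _) _; rewrite eE lecR !raddfB.
rewrite [complex.Re e]splitr lerD //; first exact: hP.
exact: hP'.
Qed.

Lemma totally_bounded_precompact (K : numFieldType) (X : Type) (S : set X)
    (Y : normedModType K) (f : X -> Y) :
  precompact (f @` S) -> totally_bounded_on S f.
Proof.
rewrite precompactE compact_cover => cf e e0.
have e2 : 0 < e / 2 by rewrite divr_gt0.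
have [|y fy|D _ Dcov] := cf Y setT (fun y => ball y (e / 2)).
- by move=> y _; exact: ball_open.
- by exists y => //; exact: ballxx.
pose Q x (y : D) := ball (val y) (e / 2) (f x).
(* A point is labelled by a chosen ball of radius e / 2 containing its image; the default [None]
   never occurs on S. *)
exists (option D), (fun x => if pselect (exists y, Q x y) is left ex
  then Some (sval (cid ex)) else None).
have Qex x : S x -> exists y, Q x y.
  move=> Sx; have [|y /= yD fxy] := Dcov (f x).
    by apply: subset_closure; exists x.
  by exists [` yD]%fset.
move=> x y Sx Sy; case: pselect => [ex|/(_ (Qex _ Sx))//].
case: pselect => [ey|/(_ (Qex _ Sy))//].
case: (cid ex) (cid ey) => [u ux] [v vy] /= [uv]; rewrite uv in ux.
have := ball_triangle (ball_sym ux) vy.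
by rewrite -splitr -ball_normE => /ltW.
Qed.

(** * Approximation numbers *)

(** Nonnegativity makes x and y comparable, so that x > y can be refuted with e half of the
    difference. *)
Lemma ler_addgt0_ge0 (K : numFieldType) (x y : K) : 0 <= x -> 0 <= y ->
  (forall e, 0 < e -> x <= y + e) -> x <= y.
Proof.
move=> x0 y0 xy; rewrite real_leNgt ?ger0_real //; apply/negP => yx.
have e0 : 0 < (x - y) / 2 by rewrite divr_gt0 ?subr_gt0.
have := xy _ e0; rewrite -lerBlDl ler_pdivlMr // ger_pMr ?subr_gt0 //.
by rewrite lt_geF // ltr1n.
Qed.

Section Approximation.
Context (R : realType) (k : scalar_kind) (m : nat).
Local Notation K := (scalars R k).
Context (X Y : normedModType K).
Implicit Types (P Q : hpoly m X Y) (L : hpoly 1 (continuous_dual Y) (hpoly m X K^o)).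

Lemma hpoly1_normP (V W : normedModType K) (T : hpoly 1 V W) x : `|T x| <= `|T| * `|x|.
Proof. by have := hpoly_normP T x; rewrite expr1. Qed.

Lemma hpoly1_0 (V W : normedModType K) (T : hpoly 1 V W) : T 0 = 0.
Proof. by have := hpolyZ T 0 0; rewrite scale0r expr1 scale0r. Qed.

Lemma hpoly1B (V W : normedModType K) (T : hpoly 1 V W) x y : T (x - y) = T x - T y.
Proof. by rewrite addrC -scaleN1r (hpoly1_linear T) scaleN1r addrC. Qed.

Lemma norming_functional (y : Y) :
  exists2 phi : continuous_dual Y, `|phi| <= 1 & `|y| <= `|phi y|.
Proof.
have [f f1 fy] := hahn_banach y (@ler_normD _ Y) (@normrZ _ Y).
have fP : (f : Y -> K^o) \in hpoly_pred 1.
  by apply: (is_hpoly1 (M := 1)) => [|x]; [exact: linearP | rewrite mul1r].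
exists (HPoly fP) => //; apply: hpoly_norm_le => x x1.
exact: le_trans (f1 x) x1.
Qed.

Lemma scale_hpoly_subproof (q : hpoly m X K^o) (y : Y) :
  (fun x => (q x : K) *: y) \in hpoly_pred m.
Proof.
have /hpolyP [A [linA ctsA qA]] := hpoly_funP q.
apply/hpolyP; exists (fun v => (A v : K) *: y); split.
- by move=> i v a x z; rewrite linA scalerDl scalerA.
- have scale_cts : continuous (fun a : K^o => (a : K) *: y).
    apply: (@linear_bound_continuous _ _ _ _ _ `|y|) => [a u v|u].
      by rewrite scalerDl scalerA.
    by rewrite normrZ mulrC.
  by move=> v; exact: (continuous_comp (ctsA v) (scale_cts _)).
- by move=> x; rewrite qA.
Qed.

Definition scale_hpoly (q : hpoly m X K^o) (y : Y) : hpoly m X Y :=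
  HPoly (scale_hpoly_subproof q y).

(** By [coord_eval], the coordinates of L phi in a basis are fixed combinations of the values of L
    phi at finitely many points, hence linear and bounded in phi. The summand 1 in the bound keeps T
    positive, as T becomes a divisor later. *)
Lemma rank_lt_decomp L n : rank_lt L n ->
  exists d (b : 'I_d -> hpoly m X K^o) (g : 'I_d -> {linear continuous_dual Y -> K^o}) (T : K),
  [/\ (d < n)%N, 0 < T, forall phi, L phi = \sum_i (g i phi : K) *: b i
    & forall i phi, `|g i phi| <= T * `|phi|].
Proof.
move=> [d dn [b [_ bi bL]]].
have bi' c : (forall x, \sum_i c i * (b i x : K) = 0) -> forall i, c i = 0.
  move=> cx; apply: bi; apply: val_inj; apply/funext => x /=.
  by rewrite hpoly_sumE -[RHS](cx x).
have [N [x [W cW]]] := coord_eval bi'.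
pose g0 i phi : K^o := \sum_j (L phi (x j) : K) * W j i.
have g0lin i : linear (g0 i).
  move=> a phi psi; rewrite /g0 scaler_sumr -big_split /=; apply: eq_bigr => j _.
  by rewrite hpoly1_linear mulrDl -mulrA.
pose g i : {linear continuous_dual Y -> K^o} :=
  HB.pack (g0 i) (GRing.isLinear.Build _ _ _ _ (g0 i) (g0lin i)).
pose T i : K := \sum_j `|L| * `|x j| ^+ m * `|W j i|.
have T0 i : 0 <= T i by apply: sumr_ge0 => j _; rewrite !mulr_ge0 ?exprn_ge0.
exists d, b, g, (1 + \sum_i T i); split => //.
- by rewrite ltr_wpDr ?ltr01 ?sumr_ge0.
- move=> phi; have [|c Lc] := bL (L phi).
    exists 1%N, (fun=> 1), (fun=> L phi); split; first by move=> _; exists phi.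
    by rewrite big_ord1 scale1r.
  rewrite {1}Lc; apply: eq_bigr => i _; congr (_ *: _).
  rewrite -[LHS]cW; apply: eq_bigr => j _; congr (_ * _).
  by rewrite Lc hpoly_sumE.
- move=> i phi; apply: (@le_trans _ _ (T i * `|phi|)).
    apply: le_trans (ler_norm_sum _ _ _) _; rewrite mulr_suml; apply: ler_sum => j _.
    rewrite normrM mulrAC ler_wpM2r // mulrAC.
    apply: le_trans (hpoly_normP _ _) _; apply: ler_wpM2r; first exact: exprn_ge0.
    exact: (hpoly1_normP L phi).
  rewrite ler_wpM2r // (bigD1 i) //= addrCA lerDl.
  by apply: addr_ge0 => //; apply: sumr_ge0 => j _; exact: T0.
Qed.

(** * From functionals on the dual to a polynomial of finite rank *)

Section Core.
Context (P : hpoly m X Y) (d : nat) (b : 'I_d -> hpoly m X K^o).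
Context (g : 'I_d -> {linear continuous_dual Y -> K^o}) (T a : K).
Hypothesis T_gt0 : 0 < T.
Hypothesis a_gt0 : 0 < a.
Hypothesis g_le : forall i phi, `|g i phi| <= T * `|phi|.
Hypothesis Pg : forall (phi : continuous_dual Y) x, `|x| <= 1 ->
  `|phi (P x) - \sum_i (b i x : K) * (g i phi : K)| <= a * `|phi|.

(* r bounds, up to any delta, the diameters under P of the finitely many pieces
   of the unit ball on which the b i are almost constant. *)
Definition clustered (r : K) := forall delta : K, 0 < delta ->
  exists (F : finType) (h : X -> F), forall x y, `|x| <= 1 -> `|y| <= 1 -> h x = h y ->
    `|P x - P y| <= r + delta /\ forall i, `|b i x - b i y| <= delta.

Let b_labels (delta : K) : 0 < delta ->
  exists (F : finType) (h : X -> F), forall x y, `|x| <= 1 -> `|y| <= 1 -> h x = h y ->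
    forall i, `|b i x - b i y| <= delta.
Proof.
move=> delta0; pose S := [set x : X | `|x| <= 1].
have := @totally_bounded_family K X S K^o 'I_d b delta delta0; apply => i.
by apply: (totally_bounded_scalar (M := `|b i|)) => x x1; exact: hpoly_norm_ge.
Qed.

Lemma clustered_compact : compact_hpoly P -> clustered 0.
Proof.
move=> /totally_bounded_precompact Ptb delta delta0.
have [F [h hP]] := b_labels delta0; have [F' [h' hP']] := Ptb _ delta0.
exists (F * F')%type, (fun x => (h x, h' x)) => x y x1 y1 [hxy hxy'].
by rewrite add0r; split; [exact: hP' | exact: hP].
Qed.

(** For phi norming P x - P y, the values phi (P x) and phi (P y) are each within a of a sum in the
    b i, and the two sums almost agree on a piece. *)
Lemma clustered_general : clustered (a + a).
Proof.
(* With accuracy delta / D for the b i, the two sums differ by at most d (delta / D) T <= delta; the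
   summand 1 gives delta / D <= delta. *)
move=> delta delta0; pose D : K := 1 + d%:R * T.
have D1 : 1 <= D by rewrite lerDl mulr_ge0 // ltW.
have D0 : 0 < D by exact: lt_le_trans ltr01 D1.
have dD : 0 < delta / D by rewrite divr_gt0.
have dD_le : delta / D <= delta by rewrite ler_pdivrMr // ler_pMr.
have [F [h hP]] := b_labels dD; exists F, h => x y x1 y1 hxy.
have bxy i := hP _ _ x1 y1 hxy i.
split; last by move=> i; exact: le_trans (bxy i) dD_le.
have [phi phi1 phiy] := norming_functional (P x - P y).
apply: le_trans phiy _; rewrite hpoly1B.
pose s x : K := \sum_i (b i x : K) * (g i phi : K).
have -> : phi (P x) - phi (P y) = (phi (P x) - s x) - (phi (P y) - s y) + (s x - s y).
  have swap (A B C D' : K) : A - B = (A - C) - (B - D') + (C - D') by ring.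
  exact: swap.
have aphi : a * `|phi| <= a by rewrite ler_piMr // ltW.
apply: le_trans (ler_normD _ _) _; apply: lerD.
  apply: le_trans (ler_normB _ _) _.
  by apply: lerD; apply: le_trans (Pg _ _) aphi.
rewrite /s -sumrB; apply: le_trans (ler_norm_sum _ _ _) _.
apply: (@le_trans _ _ (\sum_(i < d) delta / D * T)).
  apply: ler_sum => i _; rewrite -mulrBl normrM ler_pM //.
  by apply: le_trans (g_le _ _) _; rewrite ler_piMr // ltW.
rewrite sumr_const card_ord -mulr_natl mulrCA mulrAC ler_pdivrMr // ler_pM2l //.
by rewrite lerDr.
Qed.

(* The points s i come from [helly], applied to one representative of each
   piece; the extra rows (0, t s_i) bound the s i independently of the partition,
   which may thus be chosen fine enough afterwards. *)
Lemma approx_of_clustered (r e : K) n : (d < n)%N -> 0 <= r -> 0 < e -> clustered r ->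
  exists2 Q : hpoly m X Y, rank_lt Q n & `|P - Q| <= r + a + e.
Proof.
(* The factor t = a / T makes t g_i bounded by a, as [helly] requires of the extra rows; its
   conclusion t |s i| <= a + e1 then reads |s i| <= S. *)
move=> dn r0 e0 Pcl; pose t := a / T; pose e1 := e / 2; pose S := (a + e1) / t.
have t0 : 0 < t by rewrite divr_gt0.
have e1_gt0 : 0 < e1 by rewrite divr_gt0.
have S0 : 0 < S by rewrite divr_gt0 // addr_gt0.
(* This D makes delta + d S delta equal to e1, the half of e left over by [helly]. *)
pose D : K := 1 + d%:R * S.
have D0 : 0 < D by rewrite ltr_wpDr ?ltr01 // mulr_ge0 // ltW.
pose delta := e1 / D; have delta0 : 0 < delta by rewrite divr_gt0.
have [F [h hP]] := Pcl _ delta0.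
(* Each label gets a representative in the unit ball, with 0 as default for labels not attained
   there. *)
have /choice [xi xiP] : forall u : F, exists z : X, `|z| <= 1 /\
    forall x, `|x| <= 1 -> h x = u -> h z = u.
  move=> u; have [[z [z1 zu]]|nz] := pselect (exists z, `|z| <= 1 /\ h z = u).
    by exists z.
  by exists 0; rewrite normr0; split=> // x x1 xu; case: nz; exists x.
pose p (l : F + 'I_d) : Y := if l is inl u then P (xi u) else 0.
pose c (l : F + 'I_d) (i : 'I_d) : K :=
  match l with inl u => b i (xi u) | inr j => if i == j then t else 0 end.
have pc l (phi : continuous_dual Y) :
    `|phi (p l) - \sum_i c l i * g i phi| <= a * `|phi|.
  case: l => [u|j] /=; first by apply: Pg; exact: (xiP u).1.
  rewrite hpoly1_0 sub0r normrN (bigD1 j) //= eqxx big1 ?addr0 => [|i /negbTE ->].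
    by rewrite normrM gtr0_norm // /t -mulrA ler_pM2l // ler_pdivrMl.
  by rewrite mul0r.
have [s sP] := helly (ltW a_gt0) e1_gt0 pc.
have sS i : `|s i| <= S.
  have := sP (inr i); rewrite /= sub0r normrN (bigD1 i) //= eqxx big1 ?addr0.
    by rewrite normrZ gtr0_norm // -ler_pdivlMl // mulrC.
  by move=> j /negbTE ->; rewrite scale0r.
pose Q : hpoly m X Y := \sum_i scale_hpoly (b i) (s i).
have QE x : Q x = \sum_i (b i x : K) *: s i by rewrite /Q hpoly_sumE.
exists Q.
  by apply: (rank_lt_span (s := s) dn) => x; exists (fun i => b i x).
apply: hpoly_norm_le => x x1.
have -> : (P - Q) x = P x - Q x by [].
pose z := xi (h x); have [z1 /(_ x x1 erefl) hz] := xiP (h x).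
have [Pxz bxz] := hP _ _ x1 z1 (esym hz).
(* The three differences are bounded by the diameter of the piece, by [helly] at its representative,
   and by the variation of the b i against |s i| <= S. *)
have -> : P x - Q x = (P x - P z) + (P z - Q z) + (Q z - Q x).
  by rewrite !addrA !subrK.
have -> : r + a + e = (r + delta) + (a + e1) + d%:R * S * delta.
  have -> : e = e1 + (delta + d%:R * S * delta).
    by rewrite -{1}[delta]mul1r -mulrDl mulrC divfK ?gt_eqF // -splitr.
  by ring.
apply: le_trans (ler_normD _ _) _; apply: lerD.
  apply: le_trans (ler_normD _ _) _; apply: lerD => //.
  by have := sP (inl (h x)); rewrite QE.
rewrite distrC !QE -sumrB; apply: le_trans (ler_norm_sum _ _ _) _.
apply: (@le_trans _ _ (\sum_(i < d) delta * S)).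
  by apply: ler_sum => i _; rewrite -scalerBl normrZ ler_pM.
by rewrite sumr_const card_ord -[leLHS]mulr_natl [delta * S]mulrC mulrA.
Qed.

End Core.

(** * Comparison of the approximation numbers of P and of its adjoint *)

Lemma adjoint_decomp_le P L a d (b : 'I_d -> hpoly m X K^o)
    (g : 'I_d -> {linear continuous_dual Y -> K^o}) :
  (forall phi, L phi = \sum_i (g i phi : K) *: b i) -> `|adjoint P - L| <= a ->
  forall (phi : continuous_dual Y) x, `|x| <= 1 ->
  `|phi (P x) - \sum_i (b i x : K) * (g i phi : K)| <= a * `|phi|.
Proof.
move=> Lg PLa phi x x1.
have -> : \sum_i (b i x : K) * (g i phi : K) = L phi x.
  by rewrite Lg hpoly_sumE; apply: eq_bigr => i _; rewrite mulrC.
have -> : phi (P x) - L phi x = (adjoint P - L) phi x by [].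
apply: le_trans (hpoly_norm_ge _ x1) _.
apply: (le_trans (hpoly1_normP (adjoint P - L) phi)).
by rewrite ler_wpM2r.
Qed.

Lemma approx_number_le P Q n : (0 < n)%N -> rank_lt Q n -> approx_number P n <= `|P - Q|.
Proof.
by move=> n0 Qn; have [+ _] := @approx_number_infimums R k m X Y P n n0; apply; exists Q.
Qed.

Lemma approx_number_ge0 P n : (0 < n)%N -> 0 <= approx_number P n.
Proof.
by move=> n0; have [_ +] := @approx_number_infimums R k m X Y P n n0; apply => _ [Q _ <-].
Qed.

(** The composite of phi with Q depends only on the values of phi at d vectors spanning the range of
    Q. Among more than d functionals, a nontrivial combination vanishes at all these vectors, so the
    corresponding adjoint images are dependent. *)
Lemma rank_lt_adjoint Q n : rank_lt Q n -> rank_lt (adjoint Q) n.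
Proof.
move=> [d dn [y [_ _ Qy]]].
have Qxy x : exists c : 'I_d -> K, Q x = \sum_i c i *: y i.
  apply: Qy; exists 1%N, (fun=> 1), (fun=> Q x); split; first by move=> _; exists x.
  by rewrite big_ord1 scale1r.
have [j b bS bi|d' d'd Qd'] := @has_dim_le _ _ (range (adjoint Q)) d; last first.
  by exists d' => //; exact: leq_ltn_trans d'd dn.
rewrite leqNgt; apply/negP => dj.
(* The range of the adjoint is a subspace, so members of its span are themselves adjoint images. *)
have /choice [phi phib] : forall i, exists phi : continuous_dual Y, b i = adjoint Q phi.
  move=> i; have [n' [c [v [vQ ->]]]] := bS i.
  have /choice [phi phiv] : forall l, exists phi : continuous_dual Y, v l = adjoint Q phi.
    by move=> l; have [phi _ <-] := vQ l; exists phi.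
  exists (\sum_l c l *: phi l); apply: val_inj; apply/funext => x /=.
  rewrite !hpoly_sumE; apply: eq_bigr => l _.
  by rewrite phiv.
have [c [i ci] cphi] := kernel_vector (fun i l => phi i (y l) : K) dj.
suff /bi/(_ i) c0 : \sum_i c i *: b i = 0 by rewrite c0 eqxx in ci.
apply: val_inj; apply/funext => x /=; rewrite hpoly_sumE.
pose psi : continuous_dual Y := \sum_i c i *: phi i.
transitivity (psi (Q x)).
  by rewrite /psi hpoly_sumE; apply: eq_bigr => l _; rewrite phib.
have psi0 l : psi (y l) = 0 by rewrite /psi hpoly_sumE -[RHS](cphi l).
have [e ->] := Qxy x.
pose psiL : {linear Y -> K^o} :=
  HB.pack (psi : Y -> K^o) (GRing.isLinear.Build _ _ _ _ (psi : Y -> K^o) (hpoly1_linear psi)).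
rewrite -[LHS]/(psiL _) linear_sum big1 // => l _.
by rewrite linearZ /= psi0 scaler0.
Qed.

Lemma adjointB_le P Q : `|adjoint P - adjoint Q| <= `|P - Q|.
Proof.
apply: hpoly_norm_le => phi phi1; apply: hpoly_norm_le => x x1.
have -> : (adjoint P - adjoint Q) phi x = phi (P x) - phi (Q x) by [].
rewrite -hpoly1B; apply: le_trans (hpoly1_normP _ _) _.
apply: (@le_trans _ _ `|P x - Q x|); first by rewrite ler_piMl.
exact: (@hpoly_norm_ge _ _ _ _ _ (P - Q)).
Qed.

Lemma adjoint_approx_number_le P n : (0 < n)%N ->
  approx_number (adjoint P) n <= approx_number P n.
Proof.
move=> n0; have [_ +] := @approx_number_infimums R k m X Y P n n0; apply => _ [Q Qn <-].
apply: le_trans (adjointB_le P Q).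
have [+ _] := @approx_number_infimums R k 1 _ _ (adjoint P) n n0; apply.
by exists (adjoint Q) => //; exact: rank_lt_adjoint.
Qed.

Lemma approx_number_compact_le P n : (0 < n)%N -> compact_hpoly P ->
  approx_number P n <= approx_number (adjoint P) n.
Proof.
move=> n0 Pcpt.
have [_ +] := @approx_number_infimums R k 1 _ _ (adjoint P) n n0; apply => _ [L Ln <-].
apply: ler_addgt0_ge0 => // [|e e0]; first exact: approx_number_ge0.
have e2 : 0 < e / 2 by rewrite divr_gt0.
have [d [b [g [T [dn T0 Lg gT]]]]] := rank_lt_decomp Ln.
(* Half of e makes the bound on |P^* - L| strictly positive, and the other half pays for
   [approx_of_clustered]. *)
have a0 : 0 < `|adjoint P - L| + e / 2 by rewrite ltr_wpDl.
have PLa : `|adjoint P - L| <= `|adjoint P - L| + e / 2 by rewrite lerDl ltW.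
have [Q Qn PQ] := approx_of_clustered T0 a0 gT (adjoint_decomp_le Lg PLa) dn (lexx 0) e2
  (clustered_compact b Pcpt).
apply: le_trans (approx_number_le P n0 Qn) _; apply: le_trans PQ _.
by rewrite add0r -addrA -splitr.
Qed.

(* The pieces have P-diameter about 2a in general, so 3a = 2a + a replaces a. *)
Lemma approx_number_general_le P n : (0 < n)%N ->
  approx_number P n <= 3 * approx_number (adjoint P) n.
Proof.
move=> n0; rewrite -ler_pdivrMl //.
have [_ +] := @approx_number_infimums R k 1 _ _ (adjoint P) n n0; apply => _ [L Ln <-].
rewrite ler_pdivrMl //.
apply: ler_addgt0_ge0 => [||e e0]; [exact: approx_number_ge0 | exact: mulr_ge0|].
(* Four quarters of e are spent: one in each of the three copies of a, and one in
   [approx_of_clustered]. *)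
have e4 : 0 < e / 4 by rewrite divr_gt0.
have [d [b [g [T [dn T0 Lg gT]]]]] := rank_lt_decomp Ln.
pose a := `|adjoint P - L| + e / 4.
have a0 : 0 < a by rewrite ltr_wpDl.
have PLa : `|adjoint P - L| <= a by rewrite lerDl ltW.
have Pg := adjoint_decomp_le Lg PLa.
have aa0 : 0 <= a + a by rewrite addr_ge0 ?ltW.
have [Q Qn PQ] := approx_of_clustered T0 a0 gT Pg dn aa0 e4
  (clustered_general T0 a0 gT Pg).
apply: le_trans (approx_number_le P n0 Qn) _; apply: le_trans PQ _.
by rewrite le_eqVlt; apply/orP; left; apply/eqP; rewrite /a; field.
Qed.

End Approximation.

Theorem corollary4p6 (R : realType) (k : scalar_kind) (m : nat)
    (hm : (2 <= m)%N) (X Y : completeNormedModType (scalars R k)) :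
  (forall P : hpoly m X Y, compact_hpoly P ->
     forall n : nat, (0 < n)%N ->
       approx_number P n = approx_number (adjoint P) n) /\
  (forall (P : hpoly m X Y) (n : nat), (0 < n)%N ->
     approx_number P n <= 5 * approx_number (adjoint P) n).
Proof.
split=> [P Pcpt n n0|P n n0].
  by apply/eqP; rewrite eq_le approx_number_compact_le ?adjoint_approx_number_le.
(* The constant 5 follows from the smaller constant 3. *)
apply: le_trans (approx_number_general_le P n0) _.
by rewrite ler_wpM2r ?approx_number_ge0 // ler_nat.
Qed.
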